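(* Let $n \in \mathbb{N}$, $n\ge 1$. There exist a Young function $A:[0,\infty)\to[0,\infty)$ which does not satisfy the $\Delta_2$-condition and a corresponding function $u:\mathbb{R}^n\to\mathbb{R}$ such that $u\in V^{s,A}_d(\mathbb{R}^n)$ for every $s\in(0,1)$, $$\int_{\mathbb{R}^n} \overline{A}(|u(x)|)\,dx \le \int_{\mathbb{R}^n} A(|u(x)|)\,dx <\infty,$$ but $$\lim_{s\to 0^+}\; s\int_{\mathbb{R}^n} \int_{\mathbb{R}^n} A \left( \frac{|u(x) - u(y)|}{|x-y|^s}\right) \frac{dx\, dy}{|x-y|^n} =\infty.$$
   Context: A Young function is a convex function $A:[0,\infty)\to[0,\infty)$ with $A(0)=0$. It satisfies the $\Delta_2$-condition if there exists a constant $c$ such that $A(2t)\le c\,A(t)$ for all $t\ge 0$. The Young function $\overline{A}$ associated with $A$ is defined by $\overline{A}(t)=\int_0^t \frac{A(\tau)}{\tau}\,d\tau$ for $t\ge 0$. For $s\in(0,1)$, $V^{s,A}_d(\mathbb{R}^n)$ denotes the space of those measurable functions $u:\mathbb{R}^n\to\mathbb{R}$ such that $$\int_{\mathbb{R}^n} \int_{\mathbb{R}^n} A\left(\frac{|u(x)-u(y)|}{|x-y|^s}\right)\frac{dx\,dy}{|x-y|^{n}}<\infty$$ and which decay to $0$ near infinity in the sense that $|\{x\in\mathbb{R}^n: |u(x)|>t\}|<\infty$ for every $t>0$, where $|E|$ denotes the Lebesgue measure of a set $E\subset\mathbb{R}^n$. *)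

(* Defs.v *)
From HB Require Import structures.
From mathcomp Require Import all_boot all_order all_algebra.
From mathcomp Require Import all_classical all_reals all_analysis.

Set Implicit Arguments.
Unset Strict Implicit.
Unset Printing Implicit Defensive.
Import Order.TTheory GRing.Theory Num.Theory.
Import numFieldNormedType.Exports.

Local Open Scope classical_set_scope.
Local Open Scope ring_scope.

(* The library's product sigma-algebra on tuples, over the Borel sets of R, is
   the Borel sigma-algebra of R^n. *)
Definition Rn (R : realType) (n : nat) : Type := n.-tuple (measurableTypeR R).
HB.instance Definition _ (R : realType) (n : nat) :=
  Measurable.copy (Rn R n) (n.-tuple (measurableTypeR R)).

Section lebesgue_Rn.
Context {R : realType}.

Definition consRn (n : nat) (p : measurableTypeR R * Rn R n) : Rn R n.+1 :=
  [tuple of p.1 :: p.2].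

Lemma measurable_consRn (n : nat) : measurable_fun [set: _] (@consRn n).
Proof. exact: measurable_cons. Qed.

Section succ.
Local Open Scope ereal_scope.
Variables (n : nat) (mu : {sigma_finite_measure set (Rn R n) -> \bar R}).

Definition lebesgue_Rn_succ : set (Rn R n.+1) -> \bar R :=
  pushforward (lebesgue_measure \x mu) (@consRn n).

HB.instance Definition _ := Measure.copy lebesgue_Rn_succ
  (measure_function_pushforward__canonical__measure_function_Measure
    (lebesgue_measure \x mu) (@measurable_consRn n)).

Lemma lebesgue_Rn_succE (A : set (measurableTypeR R)) (B : set (Rn R n)) :
  measurable A -> measurable B ->
  lebesgue_Rn_succ [set x | A (thead x) /\ B [tuple of behead x]] =
  lebesgue_measure A * mu B.
Proof.
move=> mA mB; rewrite -product_measure1E//; congr (_ \x _).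
apply/seteqP; split=> -[a b] /=; rewrite theadE.
  move=> [Aa Bb]; split => //=.
  by rewrite (_ : b = [tuple of behead (a :: b)])//; apply/val_inj.
by move=> [Aa Bb]; split => //=; rewrite (_ : [tuple of _] = b)//; apply/val_inj.
Qed.

Let lebesgue_Rn_succ_sigma_finite : sigma_finite setT lebesgue_Rn_succ.
Proof.
have /sigma_finiteP[F [TF ndF Foo]] := sigma_finiteT (@lebesgue_measure R).
have /sigma_finiteP[G [TG ndG Goo]] := sigma_finiteT mu.
exists (fun k => [set x | F k (thead x) /\ G k [tuple of behead x]]).
  apply/seteqP; split => // x _.
  have [i _ Fi] : (\bigcup_i F i) (thead x) by rewrite -TF.
  have [j _ Gj] : (\bigcup_i G i) [tuple of behead x] by rewrite -TG.
  exists (maxn i j) => //; split.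
    by move: Fi; exact/subsetPset/ndF/leq_maxl.
  by move: Gj; exact/subsetPset/ndG/leq_maxr.
move=> k; have [mF Fk] := Foo k; have [mG Gk] := Goo k; split.
  apply: measurableI; rewrite -[X in measurable X]setTI.
    exact: (measurable_tnth ord0).
  exact: measurable_behead.
by rewrite lebesgue_Rn_succE// lte_mul_pinfty// ge0_fin_numE.
Qed.

HB.instance Definition _ := Measure_isSigmaFinite.Build _ _ _
  lebesgue_Rn_succ lebesgue_Rn_succ_sigma_finite.

End succ.

(* Lebesgue measure on R^n, as the n-fold product of the one on R. *)
Fixpoint lebesgue_Rn (n : nat) : {sigma_finite_measure set (Rn R n) -> \bar R} :=
  match n with
  | 0 => dirac ([tuple] : Rn R 0)
  | m.+1 => lebesgue_Rn_succ (lebesgue_Rn m)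
  end.

Lemma lebesgue_Rn_box (n : nat) (A : 'I_n -> set (measurableTypeR R)) :
  (forall i, measurable (A i)) ->
  lebesgue_Rn n [set x | forall i, A i (tnth x i)] =
  (\prod_(i < n) lebesgue_measure (A i))%E.
Proof.
elim: n A => [|n IH] A mA.
  rewrite big_ord0 [LHS]diracE mem_set//.
  by move=> [].
rewrite big_ord_recl -IH//= -lebesgue_Rn_succE//; last first.
  rewrite (_ : mkset _ = \bigcap_(i in [set: 'I_n])
      ((@tnth _ _)^~ i @^-1` A (lift ord0 i))); last first.
    by apply/seteqP; split => x /= Ax i *; exact: Ax.
  apply: fin_bigcap_measurable => //= i _.
  by rewrite -[X in measurable X]setTI; exact: measurable_tnth.
congr (lebesgue_Rn_succ _ _); apply/seteqP; split=> x /=.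
  move=> Ax; split=> [|i]; first exact: Ax.
  by move: (Ax (lift ord0 i)); rewrite [x in tnth x](tuple_eta x) tnthS.
move=> [A0 Ax] i; have [j ->|->//] := unliftP ord0 i.
by rewrite [x in tnth x](tuple_eta x) tnthS; exact: Ax.
Qed.

End lebesgue_Rn.

(* Only the values of A on [0, +oo[ are constrained, or ever used. *)
Definition young_function (R : realType) (A : R -> R) : Prop :=
  [/\ convex_function (`[0, +oo[%classic : set R) A,
      forall t, 0 <= t -> 0 <= A t
    & A 0 = 0].

Definition Delta2 (R : realType) (A : R -> R) : Prop :=
  exists c : R, forall t : R, 0 <= t -> A (2 * t) <= c * A t.

Definition young_bar (R : realType) (A : R -> R) (t : R) : \bar R :=
  \int[lebesgue_measure]_(tau in `[0, t]) (A tau / tau)%:E.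

Definition eucl_dist (R : realType) (n : nat) (x y : Rn R n) : R :=
  Num.sqrt (\sum_(i < n) ((tnth x i : R) - (tnth y i : R)) ^+ 2).

(* The integrand is 0 at x = y, since division by 0 returns 0 and A 0 = 0;
   the diagonal is a null set anyway. *)
Definition gagliardo (R : realType) (n : nat) (s : R) (A : R -> R)
    (u : Rn R n -> R) : \bar R :=
  \int[lebesgue_Rn n]_x \int[lebesgue_Rn n]_y
    (A (`|u x - u y| / eucl_dist x y `^ s) / eucl_dist x y ^+ n)%:E.

Definition Vd (R : realType) (n : nat) (s : R) (A : R -> R) :
    set (Rn R n -> R) :=
  [set u | [/\ measurable_fun [set: Rn R n] u,
               (gagliardo s A u < +oo)%E
             & forall t : R, 0 < t ->
                 (lebesgue_Rn n [set x | (t < `|u x|)%R] < +oo)%E]].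
Arguments Vd {R} n s A _.

(* Main.v *)
Require Import Defs.
From mathcomp Require Import all_boot all_order all_algebra.
From mathcomp Require Import all_classical all_reals all_analysis.
From mathcomp Require Import measurable_realfun ring lra.
Import Order.TTheory GRing.Theory Num.Theory.
Import numFieldNormedType.Exports.

Local Open Scope classical_set_scope.
Local Open Scope ring_scope.

(** The Young function is A(t) = t e^(-1/t), the perspective of the exponential
    and hence convex.  Since A(2t) / A(t) = 2 e^(1/(2t)) blows up at 0, doubling
    a small argument multiplies A by an unbounded factor.  The function u exploits
    this: it takes nearly opposite values g and -g on large sets that are far
    apart, so that A(|u|) is integrable although A(2|u|) is far from it.

    With |x| the sup norm and kappa = n + 1/4, put
      g(x) = 1 / (kappa ln(2 + |x|))   and   u(x) = g(x) x_0 / (2 + |x|),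
    x_0 being one fixed coordinate.  Then |u| <= g, and the exponential in A(g)
    equals (2 + |x|)^(-kappa), which is integrable because kappa > n.  As the
    integrand of the associated function is nondecreasing, that function is at
    most A.

    Finiteness of the double integral for fixed s.  Let d = |x - y| be the
    Euclidean distance.  The function u varies at the slow rate g / (2 + |x|)
    ([bipolar_lip]).  So, if x or y is far from the origin, the jump
    |u(x) - u(y)| reaches 2 max(g(x), g(y)) only when d is large, and then the
    denominator d^s is at least 2 and absorbs the factor 2.  Together with
    A(ct) <= c A(t) for 0 <= c <= 1, this bounds the integrand by
      (H(x) + H(y)) min(d^(1-s), d^(-s)) / d^n
    with H integrable ([gagliardo_integrand_le]).  The last kernel has a bounded
    integral in y, because it is dominated by a geometric combination, over the
    dyadic scales, of normalized indicators of cubes ([integral_scale_kernel]);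
    Tonelli's theorem then concludes ([kernel_integral_le]).

    Divergence as s tends to 0.  Let r = e^L with s L = 1/20.  On two opposite
    boxes of side r at distance comparable to r, the jump of u is close to
    2 / (kappa L), while d^s is close to e^(s L) = e^(1/20); the quotient is still
    at least (3/2) / (kappa L) ([jump_slab]).  There A is at least a constant times
    r^(-2 kappa / 3) / L, and the boxes contribute
      r^(2n) r^(-n) r^(-2 kappa / 3) / L >= e^(L/6) / L
    up to a constant ([gagliardo_bipolar_ge]).  Since L is 1 / (20 s), this beats
    the factor s ([gagliardo_bipolar_cvg]). *)

Set Implicit Arguments.
Unset Strict Implicit.

(** * The Young function t e^(-1/t) *)

Section exp_young.
Context {R : realType}.
Implicit Types t z : R.

(** Being constant on the negative half-line makes the function nondecreasing
    on the whole line, from which its measurability follows. *)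
Definition exp_young t : R := if 0 < t then t * expR (- t^-1) else 0.

Lemma exp_young_pos t : 0 < t -> exp_young t = t * expR (- t^-1).
Proof. by rewrite /exp_young => ->. Qed.

Lemma exp_young0 : exp_young 0 = 0 :> R.
Proof. by rewrite /exp_young ltxx. Qed.

Lemma exp_young_ge0 t : 0 <= exp_young t.
Proof.
rewrite /exp_young; case: ifP => // t0.
by rewrite mulr_ge0 ?expR_ge0// ltW.
Qed.

(** With w = 1/t this is t times the tangent inequality e^(-w) >= e^(-z) (1 + z
    - w). The left-hand side is affine in t and touches [exp_young] at t = 1/z,
    so [exp_young] is a supremum of affine functions, hence convex. *)
Lemma exp_young_ge_line z t : 0 <= t ->
  expR (- z) * (t * (1 + z) - 1) <= exp_young t.
Proof.
rewrite le_eqVlt => /predU1P[<-|t0].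
  by rewrite exp_young0 mul0r sub0r mulrN1 oppr_le0 expR_ge0.
rewrite exp_young_pos//.
have -> : t * (1 + z) - 1 = t * (1 + (z - t^-1)) by field; rewrite gt_eqF.
rewrite mulrCA ler_pM2l//.
rewrite [X in _ <= expR X](_ : _ = - z + (z - t^-1)); last by ring.
by rewrite expRD ler_pM2l ?expR_gt0// expR_ge1Dx.
Qed.

Lemma exp_young_convex :
  convex_function (`[0, +oo[%classic : set R) exp_young.
Proof.
move=> p /= x y; rewrite !inE/= !in_itv/= !andbT => x0 y0.
have a0 : 0 <= p%:num by exact: (ge0 p).
have b0 : 0 <= 1 - p%:num by rewrite subr_ge0; exact: (le1 p).
change (exp_young (p%:num * (x : R) + (1 - p%:num) * (y : R)) <=
  p%:num * exp_young x + (1 - p%:num) * exp_young y).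
move: (p%:num) a0 b0 => a a0; set b := 1 - a => b0.
move: (x : R) (y : R) x0 y0 => {x y} x y x0 y0.
set m := a * x + b * y.
have m0 : 0 <= m by rewrite addr_ge0// mulr_ge0.
rewrite le_eqVlt in m0; case/predU1P : m0 => [<-|m0].
  by rewrite exp_young0 addr_ge0// mulr_ge0// exp_young_ge0.
have hx := ler_wpM2l a0 (exp_young_ge_line m^-1 x0).
have hy := ler_wpM2l b0 (exp_young_ge_line m^-1 y0).
apply: le_trans (lerD hx hy).
rewrite exp_young_pos// le_eqVlt; apply/orP; left; apply/eqP.
transitivity (expR (- m^-1) * (m * (1 + m^-1) - 1)).
  by field; rewrite gt_eqF.
by rewrite /m /b; ring.
Qed.

Lemma exp_young_homo : {homo exp_young : s t / s <= t}.
Proof.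
move=> s t st; rewrite {1}/exp_young; case: ifPn => [s0|_].
  have t0 := lt_le_trans s0 st.
  rewrite exp_young_pos//.
  by apply: ler_pM; rewrite ?expR_ge0 ?(ltW s0)// ler_expR lerN2 lef_pV2.
exact: exp_young_ge0.
Qed.

Lemma measurable_exp_young : measurable_fun [set: R] exp_young.
Proof. exact: nondecreasing_measurable exp_young_homo. Qed.

(** The reason is that [exp_young t / t] is nondecreasing. This turns a small
    factor inside the Young function into the same factor outside. *)
Lemma exp_young_scale (c : R) t : 0 <= c <= 1 -> 0 <= t ->
  exp_young (c * t) <= c * exp_young t.
Proof.
move=> /andP[c0 c1] t0; rewrite le_eqVlt in c0.
case/predU1P : c0 => [<-|c0]; first by rewrite !mul0r exp_young0.
rewrite le_eqVlt in t0.
case/predU1P : t0 => [<-|t0]; first by rewrite mulr0 exp_young0 mulr0.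
rewrite !exp_young_pos ?mulr_gt0// -mulrA !ler_pM2l// ler_expR lerN2.
by rewrite lef_pV2 ?posrE ?mulr_gt0// ger_pMl.
Qed.

(** At t = 1/(2d) the quotient A(2t) / A(t) equals 2 e^d, which is unbounded in
    d. *)
Lemma exp_young_not_Delta2 : ~ Delta2 exp_young.
Proof.
move=> [c]; set d := `|c| + 1.
have d0 : 0 < d by rewrite ltr_wpDl.
move=> /(_ (2 * d)^-1); rewrite invr_ge0 mulr_ge0// ?(ltW d0)// => /(_ isT).
have d2 : 0 < (2 * d)^-1 by rewrite invr_gt0 mulr_gt0.
rewrite !exp_young_pos ?(mulr_gt0 _ d2)//.
have -> : 2 * (2 * d)^-1 = d^-1 by field; rewrite gt_eqF.
rewrite !invrK (_ : - (2 * d) = - d + - d); last by ring.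
rewrite expRD invfM; set e := expR (- d).
have e0 : 0 < e by exact: expR_gt0.
rewrite (_ : c * _ = d^-1 * e * (c * 2^-1 * e)); last by ring.
rewrite -[leLHS]mulr1 ler_pM2l ?mulr_gt0 ?invr_gt0//.
have : d * e <= 1.
  rewrite /e expRN ler_pdivrMr ?expR_gt0// mul1r.
  by apply: le_trans (expR_ge1Dx _); rewrite lerDr.
have : c < d by rewrite /d (le_lt_trans (ler_norm _))// ltrDl.
by nra.
Qed.

Lemma exp_young_young : young_function exp_young.
Proof.
split; [exact: exp_young_convex | by move=> *; exact: exp_young_ge0 |].
exact: exp_young0.
Qed.

Lemma exp_young_div t : exp_young t / t = if 0 < t then expR (- t^-1) else 0.
Proof.
rewrite /exp_young; case: ifPn => t0; last by rewrite mul0r.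
by rewrite mulrAC mulfV ?mul1r// gt_eqF.
Qed.

Lemma measurable_exp_young_div :
  measurable_fun [set: R] (fun t => exp_young t / t).
Proof.
rewrite (_ : (fun _ => _) = (fun t => if 0 < t then expR (- t^-1) else 0)).
  apply: nondecreasing_measurable => // x y xy.
  case: ifPn => x0; last by case: ifP => // _; exact: expR_ge0.
  have y0 := lt_le_trans x0 xy.
  by rewrite y0 ler_expR lerN2 lef_pV2.
by apply/funext => t; exact: exp_young_div.
Qed.

Lemma exp_young_div_ge0 t : 0 <= exp_young t / t.
Proof. by rewrite exp_young_div; case: ifP => // _; exact: expR_ge0. Qed.

Lemma young_bar_ge0 t : (0 <= young_bar exp_young t)%E.
Proof. by apply: integral_ge0 => x _; rewrite lee_fin exp_young_div_ge0. Qed.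

Lemma young_bar_homo : {homo young_bar exp_young : s t / s <= t >-> (s <= t)%E}.
Proof.
move=> s t st; apply: ge0_subset_integral => //.
- apply/measurable_EFinP; apply/measurable_funTS.
  exact: measurable_exp_young_div.
- by move=> x _; rewrite lee_fin exp_young_div_ge0.
- by move=> x /=; rewrite !in_itv/= => /andP[-> xs]; exact: le_trans xs st.
Qed.

(** The integrand is e^(-1/tau), which is nondecreasing, so the integral over
    [0, t] is at most t times the value at t. *)
Lemma young_bar_exp_young_le t : 0 <= t ->
  (young_bar exp_young t <= (exp_young t)%:E)%E.
Proof.
rewrite le_eqVlt => /predU1P[<-|t0].
  by rewrite /young_bar set_itv1 integral_set1 lee_fin exp_young_ge0.
rewrite /young_bar.
apply: (@le_trans _ _ ((expR (- t^-1))%:E * lebesgue_measure `[0%R, t])%E).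
  rewrite -integral_cst//.
  apply: ge0_le_integral => //.
  - by move=> x _; rewrite lee_fin exp_young_div_ge0.
  - apply/measurable_EFinP; apply/measurable_funTS.
    exact: measurable_exp_young_div.
  - move=> x; rewrite /= in_itv/= => /andP[x0 xt].
    rewrite lee_fin exp_young_div; case: ifPn => [{}x0|_].
      by rewrite ler_expR lerN2 lef_pV2.
    exact: expR_ge0.
rewrite lebesgue_measure_itv/= lte_fin t0 -EFinD -EFinM lee_fin.
by rewrite exp_young_pos// subr0 mulrC.
Qed.

(** Finite values allow measurability to be read off from real monotone
    functions. *)
Lemma young_bar_fin t : young_bar exp_young t \is a fin_num.
Proof.
rewrite ge0_fin_numE ?young_bar_ge0//.
apply: (@le_lt_trans _ _ (young_bar exp_young (Num.max 0 t))).
  by apply: young_bar_homo; rewrite le_max lexx orbT.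
apply: (@le_lt_trans _ _ (exp_young (Num.max 0 t))%:E); last by rewrite ltry.
by apply: young_bar_exp_young_le; rewrite le_max lexx.
Qed.

Lemma measurable_young_bar : measurable_fun [set: R] (young_bar exp_young).
Proof.
rewrite (_ : young_bar exp_young =
    EFin \o (fun t => fine (young_bar exp_young t))); last first.
  by apply/funext => t /=; rewrite fineK// young_bar_fin.
apply/measurable_EFinP; apply: nondecreasing_measurable => // s t st.
by rewrite fine_le ?young_bar_fin// young_bar_homo.
Qed.

End exp_young.

(** * Sup norm, cubes and Euclidean distance *)

Section euclidean.
Context {R : realType} {n : nat}.
Implicit Types (x y : Rn R n) (c r : R).

(** The coordinate as a plain real number, without the Borel structure that the
    type of points attaches to it. *)
Definition crd x (i : 'I_n) : R := tnth x i.

(** Balls of the sup norm are boxes, whose measure is a product of lengths. *)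
Definition supnorm x : R := \big[Num.max/0]_(i < n) `|crd x i|.

Definition cube x r : set (Rn R n) :=
  [set y | forall i, `|crd x i - crd y i| <= r].

Lemma supnorm_ge0 x : 0 <= supnorm x.
Proof. exact: bigmax_ge_id. Qed.

Lemma le_supnorm x i : `|crd x i| <= supnorm x.
Proof. exact: le_bigmax. Qed.

Lemma supnorm_le x c : 0 <= c -> (forall i, `|crd x i| <= c) -> supnorm x <= c.
Proof. by move=> c0 xc; apply: bigmax_le. Qed.

Lemma eucl_dist_ge0 x y : 0 <= eucl_dist x y.
Proof. exact: sqrtr_ge0. Qed.

Lemma eucl_distC x y : eucl_dist x y = eucl_dist y x.
Proof.
by congr Num.sqrt; apply: eq_bigr => i _; rewrite -opprB sqrrN.
Qed.

Lemma crd_dist x y i : `|crd x i - crd y i| <= eucl_dist x y.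
Proof.
rewrite -sqrtr_sqr ler_wsqrtr// (bigD1 i)//= lerDl.
by apply: sumr_ge0 => j _; exact: sqr_ge0.
Qed.

Lemma cube_dist x y : cube x (eucl_dist x y) y.
Proof. by move=> i; exact: crd_dist. Qed.

Lemma eucl_dist_le x y c : 0 <= c -> cube x c y -> eucl_dist x y <= n%:R * c.
Proof.
move=> c0 xyc; rewrite -[leRHS]ger0_norm ?mulr_ge0// -sqrtr_sqr ler_wsqrtr//.
apply: (@le_trans _ _ (\sum_(i < n) c ^+ 2)).
  apply: ler_sum => i _; rewrite -(real_normK (num_real (_ - _))).
  by rewrite lerXn2r ?nnegrE//; exact: xyc.
rewrite sumr_const card_ord exprMn -[leLHS]mulr_natl ler_wpM2r ?sqr_ge0//.
by rewrite -natrX ler_nat; case: (n) => // m; rewrite leq_pmulr.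
Qed.

Lemma supnorm_lip x y : `|supnorm x - supnorm y| <= eucl_dist x y.
Proof.
suff H (a b : Rn R n) : supnorm a - supnorm b <= eucl_dist a b.
  by rewrite ler_norml H lerNl opprB eucl_distC H.
rewrite lerBlDr supnorm_le ?addr_ge0 ?eucl_dist_ge0 ?supnorm_ge0// => i.
rewrite -[crd a i](subrK (crd b i)) (le_trans (ler_normD _ _))//.
by rewrite lerD ?crd_dist ?le_supnorm.
Qed.

Lemma measurable_crd i : measurable_fun [set: Rn R n] (fun x => crd x i).
Proof. exact: measurable_tnth. Qed.

Lemma measurable_supnorm : measurable_fun [set: Rn R n] supnorm.
Proof.
rewrite /supnorm.
elim: (index_enum _) => [|i s IH].
  rewrite (_ : (fun _ => _) = cst 0); first exact: measurable_cst.
  by apply/funext => x; rewrite big_nil.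
rewrite (_ : (fun _ => _) = (fun x =>
    Num.max `|crd x i| (\big[Num.max/0]_(i <- s) `|crd x i|))); last first.
  by apply/funext => x; rewrite big_cons.
apply: (@measurable_maxr _ _ _ _ (fun x => `|crd x i|)) => //.
by apply: measurableT_comp => //; exact: measurable_crd.
Qed.

Lemma measurable_eucl_dist :
  measurable_fun [set: Rn R n * Rn R n] (fun p => eucl_dist p.1 p.2).
Proof.
have msqrt : measurable_fun [set: R] (@Num.sqrt R).
  by apply: nondecreasing_measurable => // a b; exact: ler_wsqrtr.
apply: (measurableT_comp msqrt).
apply: measurable_sum => i; apply: measurable_funX; apply: measurable_funB.
  exact: (measurableT_comp (measurable_crd i) measurable_fst).
exact: (measurableT_comp (measurable_crd i) measurable_snd).
Qed.

Lemma measurable_cube_rel r :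
  measurable [set p : Rn R n * Rn R n | cube p.1 r p.2].
Proof.
rewrite (_ : mkset _ = \bigcap_(i in [set: 'I_n])
    [set p : Rn R n * Rn R n | `|crd p.1 i - crd p.2 i| <= r]); last first.
  by apply/seteqP; split => p /= pr i *; exact: pr.
apply: fin_bigcap_measurable => //= i _.
rewrite -[X in measurable X]setTI; apply: measurable_fun_le => //.
apply: measurableT_comp => //; apply: measurable_funB.
  exact: (measurableT_comp (measurable_crd i) measurable_fst).
exact: (measurableT_comp (measurable_crd i) measurable_snd).
Qed.

Lemma cube_box x r : cube x r =
  [set y | forall i, (`[crd x i - r, crd x i + r]%classic : set R) (tnth y i)].
Proof.
apply/seteqP; split => y /= + i => /(_ i); rewrite /= in_itv/= -ler_distlC //.
Qed.

Lemma measurable_box (A : 'I_n -> set (measurableTypeR R)) :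
  (forall i, measurable (A i)) ->
  measurable [set y : Rn R n | forall i, A i (tnth y i)].
Proof.
move=> mA; rewrite (_ : mkset _ = \bigcap_(i in [set: 'I_n])
    ((fun y => crd y i) @^-1` A i)); last first.
  by apply/seteqP; split => y /= Ay i *; exact: Ay.
apply: fin_bigcap_measurable => //= i _.
by rewrite -[X in measurable X]setTI; apply: measurable_crd => //; exact: mA.
Qed.

Lemma measurable_cube x r : measurable (cube x r).
Proof.
rewrite cube_box.
apply: (@measurable_box (fun i => `[crd x i - r, crd x i + r]%classic)) => i.
exact: measurable_itv.
Qed.

Lemma lebesgue_cube x r : 0 <= r ->
  lebesgue_Rn n (cube x r) = ((2 * r) ^+ n)%:E.
Proof.
move=> r0; rewrite cube_box (@lebesgue_Rn_box _ _
  (fun i => `[crd x i - r, crd x i + r]%classic)); last first.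
  by move=> i; exact: measurable_itv.
rewrite (eq_bigr (fun=> (2 * r)%:E)) => [|i _].
  by rewrite prodEFin prodr_const card_ord.
rewrite lebesgue_measure_itv/= lte_fin -EFinD.
case: ifPn => [_|]; first by congr EFin; ring.
rewrite -leNgt => h; have -> : r = 0 by lra.
by rewrite mulr0.
Qed.

Definition origin : Rn R n := [tuple 0 | i < n].

Lemma cube_origin x : cube origin (supnorm x) x.
Proof.
by move=> i; rewrite /crd tnth_mktuple sub0r normrN; exact: le_supnorm.
Qed.

End euclidean.
Arguments crd {R n} x i : simpl never.
Arguments origin {R n}.

(** * Kernels summed over scales *)

Lemma geometric_nneseries_le (R : realType) (a q : R) : 0 <= a -> 0 <= q < 1 ->
  (\sum_(0 <= k <oo) (a * q ^+ k)%:E <= (a / (1 - q))%:E)%E.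
Proof.
move=> a0 /andP[q0 q1].
have aq0 k : 0 <= a * q ^+ k by rewrite mulr_ge0// exprn_ge0.
apply: lime_le.
  by apply: is_cvg_nneseries => k _ _; rewrite lee_fin.
apply: nearW => N; rewrite sumEFin lee_fin.
have -> : \sum_(0 <= k < N) a * q ^+ k = a * (1 - q ^+ N) / (1 - q).
  have := geometric_seriesE a (negbT (lt_eqF q1)).
  by move/(congr1 (fun u => u N)).
rewrite ler_pM2r ?invr_gt0 ?subr_gt0// ler_piMr// gerBl exprn_ge0//.
Qed.

Section dyadic_kernel.
Context {R : realType} {n : nat}.
Variables (q : R) (r : nat -> R).
Hypotheses (q01 : 0 <= q < 1) (r0 : forall k, 0 < r k).
Local Open Scope ereal_scope.

(** The factor r_k^(-n) normalizes the indicator of the cube, so that the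
    integral in the second variable is 2^n q^k whatever the scale r_k is. *)
Definition scale_term k (p : Rn R n * Rn R n) : \bar R :=
  (q ^+ k / r k ^+ n * \1_[set p | cube p.1 (r k) p.2] p)%:E.

Definition scale_kernel (p : Rn R n * Rn R n) : \bar R :=
  \sum_(0 <= k <oo) scale_term k p.

Let scale_term_ge0 k p : 0 <= scale_term k p.
Proof.
case/andP: q01 => q0 _.
by rewrite lee_fin mulr_ge0// divr_ge0// exprn_ge0// ltW.
Qed.

Let measurable_scale_term k : measurable_fun setT (scale_term k).
Proof.
apply/measurable_EFinP; apply: measurable_funM => //.
by apply: measurable_indic; exact: measurable_cube_rel.
Qed.

Lemma scale_kernel_ge0 p : 0 <= scale_kernel p.
Proof. by apply: nneseries_ge0 => k _ _; exact: scale_term_ge0. Qed.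

Lemma measurable_scale_kernel : measurable_fun setT scale_kernel.
Proof. by apply: ge0_emeasurable_sum => k *. Qed.

Lemma scale_kernelC x y : scale_kernel (x, y) = scale_kernel (y, x).
Proof.
apply: eq_eseriesr => k _; rewrite /scale_term !indicE.
congr (_ * (nat_of_bool _)%:R)%:E.
by apply/idP/idP; rewrite !inE => h i; rewrite distrC; exact: h.
Qed.

Lemma scale_kernel_ge k x y : cube x (r k) y ->
  (q ^+ k / r k ^+ n)%:E <= scale_kernel (x, y).
Proof.
move=> xy; rewrite (le_trans _ (@nneseries_lim_ge _ _ xpredT 0 k.+1 _))//.
rewrite big_nat_recr//= {2}/scale_term indicE mem_set// mulr1 leeDr//.
exact: sume_ge0.
Qed.

(** The scales drop out of the integrals of the terms, which leaves a geometric
    series with a bound uniform in x. *)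
Lemma integral_scale_kernel x :
  \int[lebesgue_Rn n]_y scale_kernel (x, y) <= (2 ^+ n / (1 - q))%:E.
Proof.
case/andP: (q01) => q0 q1.
rewrite integral_nneseries//; last first.
  by move=> k; exact: measurable_fun_pair2.
apply: le_trans (geometric_nneseries_le _ q01); last by rewrite exprn_ge0.
apply: lee_nneseries => [k _ _|k _]; first exact: integral_ge0.
have rk0 : (0 < r k ^+ n)%R by rewrite exprn_gt0.
under eq_integral do rewrite /scale_term EFinM.
rewrite ge0_integralZl//; first last.
- by rewrite lee_fin divr_ge0 ?(ltW rk0)// exprn_ge0.
- have mc : measurable_fun setT
      (\1_[set p : Rn R n * Rn R n | cube p.1 (r k) p.2] : _ -> R).
    by apply: measurable_indic; exact: measurable_cube_rel.
  apply/measurable_EFinP; exact: (measurable_fun_pair2 x mc).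
rewrite (eq_integral (fun y => (\1_(cube x (r k)) y)%:E)) => [|y _]; last first.
  by rewrite !indicE; congr ((nat_of_bool _)%:R)%:E.
rewrite integral_indic//; last exact: measurable_cube.
rewrite setIT [X in _ * X](_ : _ = ((2 * r k) ^+ n)%:E); last first.
  by apply: lebesgue_cube; exact: ltW.
rewrite -EFinM lee_fin exprMn mulrCA mulrA.
by rewrite le_eqVlt; apply/orP; left; apply/eqP; field; rewrite gt_eqF.
Qed.

End dyadic_kernel.

Section kernel_bound.
Context {R : realType} {n : nat}.
Local Open Scope ereal_scope.

(** Of the two terms in the bound, the one with [H x] is integrated in y first.
    The one with [H y] has the same double integral, by Tonelli and the
    symmetry of K. *)
Lemma kernel_integral_le (F K : Rn R n * Rn R n -> \bar R)
    (H : Rn R n -> \bar R) (C : R) :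
  (0 <= C)%R ->
  measurable_fun setT F -> measurable_fun setT K -> measurable_fun setT H ->
  (forall p, 0 <= F p) -> (forall p, 0 <= K p) -> (forall x, 0 <= H x) ->
  (forall x y, K (x, y) = K (y, x)) ->
  (forall x, \int[lebesgue_Rn n]_y K (x, y) <= C%:E) ->
  (forall x y, F (x, y) <= (H x + H y) * K (x, y)) ->
  \int[lebesgue_Rn n]_x \int[lebesgue_Rn n]_y F (x, y) <=
    (2 * C)%:E * \int[lebesgue_Rn n]_x H x.
Proof.
move=> C0 mF mK mH F0 K0 H0 symK intK FHK.
pose G1 p := H p.1 * K p.
pose G2 p := H p.2 * K p.
have mG1 : measurable_fun setT G1.
  by apply: emeasurable_funM => //; exact: measurableT_comp.
have mG2 : measurable_fun setT G2.
  by apply: emeasurable_funM => //; exact: measurableT_comp.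
have G10 p : 0 <= G1 p by exact: mule_ge0.
have G20 p : 0 <= G2 p by exact: mule_ge0.
have mI (G : Rn R n * Rn R n -> \bar R) :
    measurable_fun setT G -> (forall p, 0 <= G p) ->
  measurable_fun setT (fun x => \int[lebesgue_Rn n]_y G (x, y)).
  by move=> mG G0; exact: measurable_fun_fubini_tonelli_F.
have m2 (G : Rn R n * Rn R n -> \bar R) x : measurable_fun setT G ->
  measurable_fun setT (fun y => G (x, y)).
  by move=> mG; exact: measurable_fun_pair2.
have I0 (G : Rn R n * Rn R n -> \bar R) x : (forall p, 0 <= G p) ->
    0 <= \int[lebesgue_Rn n]_y G (x, y).
  by move=> G0; exact: integral_ge0.
have intG1 : \int[lebesgue_Rn n]_x \int[lebesgue_Rn n]_y G1 (x, y) <=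
    C%:E * \int[lebesgue_Rn n]_x H x.
  rewrite -ge0_integralZl//; apply: ge0_le_integral => //.
  - by move=> x _; exact: I0.
  - exact: mI.
  - exact: emeasurable_funM.
  - move=> x _; rewrite /G1/= ge0_integralZl//; last exact: m2.
    by rewrite muleC lee_wpmul2r.
have intG2 : \int[lebesgue_Rn n]_x \int[lebesgue_Rn n]_y G2 (x, y) <=
    C%:E * \int[lebesgue_Rn n]_x H x.
  rewrite (fubini_tonelli G2 mG2 G20); apply: le_trans intG1.
  by under eq_integral do under eq_integral do rewrite /G2/= symK.
apply: (@le_trans _ _ (\int[lebesgue_Rn n]_x
  (\int[lebesgue_Rn n]_y G1 (x, y) + \int[lebesgue_Rn n]_y G2 (x, y)))).
  apply: ge0_le_integral => //.
  - by move=> x _; exact: I0.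
  - exact: mI.
  - by apply: emeasurable_funD; exact: mI.
  - move=> x _; rewrite -ge0_integralD//; [|exact: m2..].
    apply: ge0_le_integral => //.
    + exact: m2.
    + by apply: emeasurable_funD; exact: m2.
    + by move=> y _; rewrite (le_trans (FHK x y))// ge0_muleDl.
rewrite ge0_integralD//; [|by move=> x _; exact: I0|exact: mI|
  by move=> x _; exact: I0|exact: mI].
apply: le_trans (leeD intG1 intG2) _.
have I0H : 0 <= \int[lebesgue_Rn n]_x H x by exact: integral_ge0.
by rewrite -ge0_muleDl ?lee_fin// -EFinD -mulr2n mulr_natl.
Qed.

End kernel_bound.

(** * The function u and its envelope *)

Lemma ln_ge_half (R : realType) (a : R) : 2 <= a -> 2^-1 <= ln a.
Proof.
move=> a2; rewrite -[leLHS]expRK ler_ln ?posrE ?expR_gt0//; last by lra.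
apply: le_trans a2; rewrite -[_^-1]opprK expRN invf_ple ?posrE ?expR_gt0//.
by apply: le_trans (expR_ge1Dx _); lra.
Qed.

Section profile.
Context {R : realType}.
Implicit Types a b : R.

(** The radial factor of [bipolar]: up to the factor 1 / kappa, u(x) is the
    coordinate x_0 times this function of the sup norm. *)
Definition logprofile a : R := ((2 + a) * ln (2 + a))^-1.

Lemma ln2D_gt0 a : 0 <= a -> 0 < ln (2 + a).
Proof. by move=> a0; apply: ln_gt0; lra. Qed.

Lemma logprofile_gt0 a : 0 <= a -> 0 < logprofile a.
Proof. by move=> a0; rewrite invr_gt0 mulr_gt0 ?ln2D_gt0//; lra. Qed.

(** The derivative of (2 + a) ln(2 + a) is ln(2 + a) + 1, which is at most 3
    ln(2 + a) since ln(2 + a) >= 1/2. Dividing by the product of the two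
    denominators and using b <= 2 + b leaves one factor 2 + a, taken at the
    larger point, and one logarithm, taken at the smaller point. *)
Lemma logprofile_diff a b : 0 <= b -> b <= a ->
  b * `|logprofile b - logprofile a| <= 3 * (a - b) / ((2 + a) * ln (2 + b)).
Proof.
move=> b0 ba; have a0 := le_trans b0 ba.
have lb0 := ln2D_gt0 b0; have la0 := ln2D_gt0 a0.
have la2 : 2^-1 <= ln (2 + a) by apply: ln_ge_half; lra.
have lab : ln (2 + b) <= ln (2 + a) by rewrite ler_ln ?posrE//; lra.
have a20 : 0 < 2 + a by lra.
have b20 : 0 < 2 + b by lra.
have lnab : (2 + b) * (ln (2 + a) - ln (2 + b)) <= a - b.
  rewrite -ln_div ?posrE//.
  rewrite (_ : (2 + a) / (2 + b) = 1 + (a - b) / (2 + b)); last first.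
    by field; rewrite gt_eqF.
  rewrite mulrC -ler_pdivlMr// le_ln1Dx// (@lt_le_trans _ _ 0)//.
  by rewrite divr_ge0 ?subr_ge0// ltW.
rewrite /logprofile.
move: (ln (2 + a)) (ln (2 + b)) lb0 la0 la2 lab lnab.
move=> la lb lb0 la0 la2 lab lnab.
have -> : ((2 + b) * lb)^-1 - ((2 + a) * la)^-1 =
    ((a - b) * la + (2 + b) * (la - lb)) / ((2 + a) * lb) / ((2 + b) * la).
  by field; rewrite !gt_eqF.
rewrite ger0_norm; last first.
  rewrite !mulr_ge0 ?invr_ge0 ?addr_ge0 ?mulr_ge0//; lra.
rewrite [leLHS](_ : _ = (b * ((a - b) * la + (2 + b) * (la - lb)) /
    ((2 + b) * la)) * ((2 + a) * lb)^-1); last by field; rewrite !gt_eqF.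
rewrite ler_wpM2r// ?invr_ge0 ?mulr_ge0 ?(ltW a20) ?(ltW lb0)//.
rewrite ler_pdivrMr ?mulr_gt0//.
have h1 : b * ((a - b) * la + (2 + b) * (la - lb)) <=
   (2 + b) * ((a - b) * la + (a - b)).
  have h2 : 0 <= (a - b) * la by rewrite mulr_ge0 ?(ltW la0)//; lra.
  have h3 : 0 <= (2 + b) * (la - lb) by rewrite mulr_ge0; lra.
  by apply: ler_pM; lra.
apply: (le_trans h1).
have : 0 <= (2 + b) * ((a - b) * (2 * la - 1)).
  by apply: mulr_ge0; [lra|apply: mulr_ge0; lra].
by lra.
Qed.

End profile.

Section extremal.
Context {R : realType} {n : nat}.
Variable i0 : 'I_n.
Implicit Types x y : Rn R n.

(** The envelope is built so that e^(-1/g) = (2 + |x|)^(-kappa). Integrability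
    of A(g) needs kappa > n, and the lower bound needs 2 kappa / 3 < n; the
    latter holds for every n >= 1 with this choice. *)
Definition kappa : R := n%:R + 4^-1.

Definition envelope x : R := kappa^-1 * (ln (2 + supnorm x))^-1.

Definition bipolar x : R := kappa^-1 * (crd x i0 * logprofile (supnorm x)).

Lemma dim_ge1 : 1 <= n%:R :> R.
Proof. by rewrite ler1n; case: i0 => m; exact: leq_trans. Qed.

Lemma kappa_ge1 : 1 <= kappa.
Proof. by have := dim_ge1; rewrite /kappa; lra. Qed.

Lemma kappa_gt0 : 0 < kappa.
Proof. exact: lt_le_trans kappa_ge1. Qed.

Lemma envelope_gt0 x : 0 < envelope x.
Proof. by rewrite mulr_gt0 ?invr_gt0 ?kappa_gt0 ?ln2D_gt0 ?supnorm_ge0. Qed.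

Lemma envelope_le2 x : envelope x <= 2.
Proof.
have N0 := supnorm_ge0 x.
rewrite -[leRHS]mul1r ler_pM ?invr_ge0 ?(ltW kappa_gt0) ?(ltW (ln2D_gt0 _))//.
  by rewrite invf_le1 ?kappa_gt0 ?kappa_ge1.
by rewrite invf_ple ?posrE ?ln2D_gt0// ln_ge_half// lerDl.
Qed.

Lemma envelope_anti x y : supnorm y <= supnorm x -> envelope x <= envelope y.
Proof.
move=> yx; have Nx := supnorm_ge0 x; have Ny := supnorm_ge0 y.
rewrite ler_pM2l ?invr_gt0 ?kappa_gt0//.
rewrite lef_pV2 ?posrE ?ln2D_gt0// ler_ln ?posrE; lra.
Qed.

Lemma bipolar_le x : `|bipolar x| <= envelope x.
Proof.
have N0 := supnorm_ge0 x; have l0 := ln2D_gt0 N0.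
rewrite normrM ger0_norm ?invr_ge0 ?(ltW kappa_gt0)//.
rewrite ler_pM2l ?invr_gt0 ?kappa_gt0//.
rewrite normrM (ger0_norm (ltW (logprofile_gt0 N0))) /logprofile invfM mulrA.
rewrite ler_piMl ?invr_ge0 ?(ltW l0)// ler_pdivrMr ?mul1r; last by lra.
by apply: le_trans (le_supnorm x i0) _; lra.
Qed.

(** The gain of the factor 1 / (2 + |x|) is what keeps the jump of u over
    bounded distances below the envelope, far away from the origin. *)
Lemma bipolar_lip x y : supnorm y <= supnorm x ->
  `|bipolar x - bipolar y| <=
    4 * envelope y * eucl_dist x y / (2 + supnorm x).
Proof.
move=> yx; have Nx := supnorm_ge0 x; have Ny := supnorm_ge0 y.
have lx := ln2D_gt0 Nx; have ly := ln2D_gt0 Ny.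
have d0 := eucl_dist_ge0 x y.
have Nlip : supnorm x - supnorm y <= eucl_dist x y.
  exact: le_trans (ler_norm _) (supnorm_lip x y).
have x20 : 0 < 2 + supnorm x by lra.
rewrite /bipolar -mulrBr normrM ger0_norm ?invr_ge0 ?(ltW kappa_gt0)//.
rewrite /envelope !(mulrCA 4) -!mulrA ler_pM2l ?invr_gt0 ?kappa_gt0//.
set hx := logprofile (supnorm x); set hy := logprofile (supnorm y).
have -> : crd x i0 * hx - crd y i0 * hy =
    (crd x i0 - crd y i0) * hx + crd y i0 * (hx - hy) by ring.
apply: le_trans (ler_normD _ _) _; rewrite !normrM.
set l := (ln (2 + supnorm y))^-1; set d := eucl_dist x y.
set m := (2 + supnorm x)^-1.
have m0 : 0 < m by rewrite invr_gt0.
have l0 : 0 < l by rewrite invr_gt0.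
have h1 : `|crd x i0 - crd y i0| * `|hx| <= d * (l * m).
  rewrite ler_pM ?crd_dist// (ger0_norm (ltW (logprofile_gt0 Nx))).
  rewrite /hx /logprofile invfM mulrC ler_wpM2r ?(ltW m0)//.
  by rewrite lef_pV2 ?posrE// ler_ln ?posrE//; lra.
have h2 : `|crd y i0| * `|hx - hy| <= 3 * d * (l * m).
  apply: (@le_trans _ _ (supnorm y * `|hy - hx|)).
    by rewrite distrC ler_wpM2r// le_supnorm.
  apply: (le_trans (logprofile_diff Ny yx)).
  rewrite invfM (mulrC _^-1 (ln _)^-1) -/m -/l.
  rewrite ler_wpM2r ?(ltW (mulr_gt0 _ _))//.
  by rewrite ler_pM2l.
by apply: le_trans (lerD h1 h2) _; lra.
Qed.

Lemma measurable_ln_supnorm :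
  measurable_fun [set: Rn R n] (fun x => ln (2 + supnorm x)).
Proof.
apply: (measurableT_comp (@measurable_ln R)); apply: measurable_funD => //.
exact: measurable_supnorm.
Qed.

Lemma measurable_envelope : measurable_fun [set: Rn R n] envelope.
Proof.
rewrite (_ : envelope =
    fun x => kappa^-1 * (ln (2 + supnorm x)) `^ (-1)); last first.
  apply/funext => x; rewrite /envelope powR_inv1//.
  by rewrite ltW// ln2D_gt0// supnorm_ge0.
apply: measurable_funM => //.
exact: (measurableT_comp (measurable_powR _) measurable_ln_supnorm).
Qed.

Lemma measurable_bipolar : measurable_fun [set: Rn R n] bipolar.
Proof.
rewrite (_ : bipolar =
    fun x => envelope x * (crd x i0 * (2 + supnorm x) `^ (-1))); last first.
  apply/funext => x; have N0 := supnorm_ge0 x.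
  by rewrite /envelope /bipolar /logprofile powR_inv1 ?invfM; [ring|lra].
apply: measurable_funM; first exact: measurable_envelope.
apply: measurable_funM; first exact: measurable_crd.
apply: (measurableT_comp (measurable_powR _)); apply: measurable_funD => //.
exact: measurable_supnorm.
Qed.

End extremal.

(** * Domination of truncated Riesz kernels *)

Lemma dyadic_bracket (R : realType) (e : R) : 1 <= e ->
  exists k, 2 ^+ k <= e < 2 ^+ k.+1.
Proof.
move=> e1.
have ex : exists k, e < 2 ^+ k by exists (Num.bound e); exact: upper_nthrootP.
case: (ex_minnP ex) => -[|k] ek kmin.
  by move: ek; rewrite expr0 ltNge e1.
exists k; rewrite ek andbT leNgt; apply/negP => /kmin.
by rewrite ltnn.
Qed.

Section riesz_kernel.
Context {R : realType} {n : nat}.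
Implicit Types (x y : Rn R n) (s e d : R).

(** Scales 2^(k+1), used for distances at least 1. *)
Definition far_kernel s : Rn R n * Rn R n -> \bar R :=
  scale_kernel (2 `^ (- s)) (fun k => 2 ^+ k.+1).

(** Scales 2^(-k), used for distances at most 1. *)
Definition near_kernel s : Rn R n * Rn R n -> \bar R :=
  scale_kernel (2 `^ (- s)) (fun k => (2 ^+ k)^-1).

Lemma powR2N_itv s : 0 < s -> 0 <= (2 : R) `^ (- s) < 1.
Proof.
move=> s0; rewrite powR_ge0/= powRN invf_lt1 ?powR_gt0//.
have : (1 : R) `^ s < 2 `^ s by rewrite gt0_ltr_powR ?nnegrE ?ltr1n.
by rewrite powR1.
Qed.

Lemma powR2N_exp s k : (2 `^ (- s)) ^+ k = ((2 ^+ k) `^ s)^-1 :> R.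
Proof.
rewrite powRN exprVn; congr (_^-1).
rewrite -[LHS]powR_mulrn; last exact: powR_ge0.
by rewrite powRAC powR_mulrn// ler0n.
Qed.

(** If 2^k <= e < 2^(k+1), the term of index k alone dominates: the cube
    contains y, and the factor 2^n makes up for the scale being 2^(k+1) and not
    2^k. *)
Lemma far_kernel_ge s e x y : 0 < s -> 1 <= e -> cube x e y ->
  (((e `^ s)^-1 / e ^+ n)%:E <= (2 ^+ n)%:E * far_kernel s (x, y))%E.
Proof.
move=> s0 e1 xy; have [k /andP[ke ek]] := dyadic_bracket e1.
have k0 : 0 < 2 ^+ k :> R by rewrite exprn_gt0.
have e0 : 0 < e by rewrite (lt_le_trans _ e1).
have xyk : cube x (2 ^+ k.+1) y by move=> i; rewrite (le_trans (xy i))// ltW.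
have := @scale_kernel_ge R n _ _ (powR2N_itv s0)
  (fun k => exprn_gt0 k.+1 (ltr0n R 2)) k x y xyk.
move=> /(lee_wpmul2l (_ : (0%R <= (2 ^+ n)%:E)%E)) h.
apply: le_trans (h _); last by rewrite lee_fin exprn_ge0.
rewrite -EFinM lee_fin powR2N_exp exprS exprMn.
rewrite [leRHS](_ : _ = ((2 ^+ k) `^ s)^-1 / (2 ^+ k) ^+ n); last first.
  by field; rewrite ?gt_eqF ?powR_gt0 ?exprn_gt0.
apply: ler_pM; rewrite ?invr_ge0 ?powR_ge0 ?exprn_ge0 ?(ltW e0)//.
  rewrite lef_pV2 ?posrE ?powR_gt0//.
  by rewrite ge0_ler_powR ?nnegrE ?(ltW s0) ?(ltW k0) ?(ltW e0).
by rewrite lef_pV2 ?posrE ?exprn_gt0// lerXn2r ?nnegrE ?(ltW k0) ?(ltW e0).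
Qed.

(** The same argument, applied to 1/d. *)
Lemma near_kernel_ge s d x y : 0 < s -> 0 < d <= 1 -> cube x d y ->
  ((d `^ s / d ^+ n)%:E <= (2 ^+ n)%:E * near_kernel s (x, y))%E.
Proof.
move=> s0 /andP[d0 d1] xy.
have e1 : 1 <= d^-1 by rewrite invf_ge1.
have [k /andP[ke ek]] := dyadic_bracket e1.
have k0 : 0 < 2 ^+ k :> R by rewrite exprn_gt0.
have xyk : cube x (2 ^+ k)^-1 y.
  move=> i; rewrite (le_trans (xy i))//.
  by rewrite -[leLHS]invrK lef_pV2 ?posrE ?invr_gt0.
have r0 j : 0 < (2 ^+ j)^-1 :> R by rewrite invr_gt0 exprn_gt0.
have := @scale_kernel_ge R n _ _ (powR2N_itv s0) r0 k x y xyk.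
move=> /(lee_wpmul2l (_ : (0%R <= (2 ^+ n)%:E)%E)) h.
apply: le_trans (h _); last by rewrite lee_fin exprn_ge0.
rewrite -EFinM lee_fin powR2N_exp exprVn invrK.
rewrite mulrCA -exprMn -exprS.
rewrite ler_pM ?powR_ge0 ?invr_ge0 ?exprn_ge0 ?(ltW d0)//.
  rewrite -[leLHS]invrK -powRN lef_pV2 ?posrE ?powR_gt0//.
  rewrite powRN -powR_inv1 ?powR_ge0// powRAC powR_inv1 ?(ltW d0)//.
  by rewrite ge0_ler_powR ?nnegrE ?(ltW s0) ?(ltW k0) ?invr_ge0 ?(ltW d0).
by rewrite -exprVn lerXn2r ?nnegrE ?invr_ge0 ?(ltW d0) ?exprn_ge0 ?(ltW ek).
Qed.

Definition riesz_bound s p : \bar R :=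
  ((2 ^+ n)%:E * far_kernel s p + (2 ^+ n)%:E * near_kernel (1 - s) p)%E.

Let far_r0 k : 0 < 2 ^+ k.+1 :> R. Proof. by rewrite exprn_gt0. Qed.
Let near_r0 k : 0 < (2 ^+ k)^-1 :> R. Proof. by rewrite invr_gt0 exprn_gt0. Qed.

Lemma measurable_far_kernel s : 0 < s -> measurable_fun setT (far_kernel s).
Proof.
by move=> s0; apply: measurable_scale_kernel => //; exact: powR2N_itv.
Qed.

Lemma measurable_near_kernel s : 0 < s -> measurable_fun setT (near_kernel s).
Proof.
by move=> s0; apply: measurable_scale_kernel => //; exact: powR2N_itv.
Qed.

Lemma far_kernel_ge0 s p : 0 < s -> (0 <= far_kernel s p)%E.
Proof. by move=> s0; apply: scale_kernel_ge0 => //; exact: powR2N_itv. Qed.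

Lemma near_kernel_ge0 s p : 0 < s -> (0 <= near_kernel s p)%E.
Proof. by move=> s0; apply: scale_kernel_ge0 => //; exact: powR2N_itv. Qed.

Lemma integral_far_kernel s x : 0 < s ->
  (\int[lebesgue_Rn n]_y far_kernel s (x, y) <=
    (2 ^+ n / (1 - 2 `^ (- s)))%:E)%E.
Proof. by move=> s0; apply: integral_scale_kernel => //; exact: powR2N_itv. Qed.

Lemma integral_near_kernel s x : 0 < s ->
  (\int[lebesgue_Rn n]_y near_kernel s (x, y) <=
    (2 ^+ n / (1 - 2 `^ (- s)))%:E)%E.
Proof. by move=> s0; apply: integral_scale_kernel => //; exact: powR2N_itv. Qed.

Section bound.
Variable s : R.
Hypothesis s01 : 0 < s < 1.
Let s0 : 0 < s. Proof. by case/andP: s01. Qed.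
Let s1 : 0 < 1 - s. Proof. by case/andP: s01; lra. Qed.
Let c0 : (0%R <= (2 ^+ n : R)%:E)%E. Proof. by rewrite lee_fin exprn_ge0. Qed.

Lemma riesz_bound_ge0 p : (0 <= riesz_bound s p)%E.
Proof. by rewrite adde_ge0// mule_ge0// ?far_kernel_ge0 ?near_kernel_ge0. Qed.

Lemma measurable_riesz_bound : measurable_fun setT (riesz_bound s).
Proof.
apply: emeasurable_funD; apply: emeasurable_funM => //.
  exact: measurable_far_kernel.
exact: measurable_near_kernel.
Qed.

Lemma riesz_boundC x y : riesz_bound s (x, y) = riesz_bound s (y, x).
Proof. by congr (_ * _ + _ * _)%E; exact: scale_kernelC. Qed.

Lemma integral_riesz_bound : exists2 C : R, 0 <= C &
  forall x, (\int[lebesgue_Rn n]_y riesz_bound s (x, y) <= C%:E)%E.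
Proof.
pose c t : R := 2 ^+ n * (2 ^+ n / (1 - 2 `^ (- t))).
have cge0 t : 0 < t -> 0 <= c t.
  move=> t0; have /andP[_ h] := powR2N_itv t0.
  by rewrite mulr_ge0 ?divr_ge0 ?exprn_ge0// subr_ge0 ltW.
exists (c s + c (1 - s)); first by rewrite addr_ge0// cge0.
move=> x; have m1 := measurable_fun_pair2 x (measurable_far_kernel s0).
have m2 := measurable_fun_pair2 x (measurable_near_kernel s1).
rewrite ge0_integralD//; first last.
- exact: emeasurable_funM.
- by move=> y _; rewrite mule_ge0// near_kernel_ge0.
- exact: emeasurable_funM.
- by move=> y _; rewrite mule_ge0// far_kernel_ge0.
rewrite !ge0_integralZl//; last 2 first.
- by move=> y _; rewrite near_kernel_ge0.
- by move=> y _; rewrite far_kernel_ge0.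
rewrite EFinD /c !(EFinM (2 ^+ n)) leeD// lee_wpmul2l//.
  exact: integral_far_kernel.
exact: integral_near_kernel.
Qed.

(** This is min(d^(1-s), d^(-s)). Near the diagonal the Lipschitz bound on u
    saves one power of d; away from it d^(-s) remains. *)
Definition cutoff s d : R := if d <= 1 then d `^ (1 - s) else (d `^ s)^-1.

Lemma cutoff_ge0 d : 0 <= cutoff s d.
Proof. by rewrite /cutoff; case: ifP => _; rewrite ?invr_ge0 powR_ge0. Qed.

Lemma riesz_bound_ge x y : 0 < eucl_dist x y ->
  ((cutoff s (eucl_dist x y) / eucl_dist x y ^+ n)%:E <=
    riesz_bound s (x, y))%E.
Proof.
set d := eucl_dist x y => d0; rewrite /cutoff; case: ifPn => [d1|].
  apply: le_trans (near_kernel_ge s1 _ (@cube_dist _ _ x y)) _.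
    by rewrite d0.
  by rewrite leeDr// mule_ge0// far_kernel_ge0.
rewrite -ltNge => d1.
apply: le_trans (far_kernel_ge s0 (ltW d1) (@cube_dist _ _ x y)) _.
by rewrite leeDl// mule_ge0// near_kernel_ge0.
Qed.

End bound.
End riesz_kernel.

(** * Finiteness of the Gagliardo integral *)

Section upper.
Context {R : realType} {n : nat}.
Variable i0 : 'I_n.
Implicit Types (x y : Rn R n) (s : R).
Notation A := (@exp_young R).
Notation u := (@bipolar R n i0).
Notation g := (@envelope R n).
Notation mu := (@lebesgue_Rn R n).

Let n0 : (0 < n)%N. Proof. by case: i0 => m; exact: leq_trans. Qed.

(** By construction of kappa, the exponential factor is (2 + |x|)^(-n - 1/4);
    the factor in front of it is at most 2. *)
Lemma exp_young_envelope_le x :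
  A (g x) <= 2 * ((2 + supnorm x) `^ 4^-1)^-1 / (2 + supnorm x) ^+ n.
Proof.
have N0 := supnorm_ge0 x; have e0 : 0 < 2 + supnorm x by lra.
rewrite exp_young_pos ?envelope_gt0// -mulrA.
apply: ler_pM; rewrite ?expR_ge0 ?(ltW (envelope_gt0 i0 x)) ?envelope_le2//.
rewrite /envelope invfM !invrK expRN mulrC expRM lnK ?posrE//.
by rewrite /kappa powRD ?gt_eqF ?implybT// powR_mulrn ?(ltW e0)// invfM mulrC.
Qed.

Lemma integral_exp_young_envelope :
  (\int[mu]_x (A (g x))%:E < +oo)%E.
Proof.
have q0 : 0 < 4^-1 :> R by rewrite invr_gt0.
have mf := measurable_fun_pair2 origin (@measurable_far_kernel R n _ q0).
apply: (@le_lt_trans _ _ (\int[mu]_x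
    ((2 * 2 ^+ n)%:E * far_kernel 4^-1 (origin, x)))%E).
  apply: ge0_le_integral => //.
  - by move=> x _; rewrite lee_fin exp_young_ge0.
  - apply/measurable_EFinP; apply: (measurableT_comp (@measurable_exp_young R)).
    exact: measurable_envelope.
  - exact: emeasurable_funM.
  - move=> x _; have N0 := supnorm_ge0 x.
    rewrite EFinM -muleA.
    apply: (@le_trans _ _ (2%:E *
        (((2 + supnorm x) `^ 4^-1)^-1 / (2 + supnorm x) ^+ n)%:E)%E).
      by rewrite -EFinM lee_fin mulrA exp_young_envelope_le.
    rewrite lee_wpmul2l// far_kernel_ge//; first by lra.
    by move=> i; rewrite (le_trans (cube_origin x i))//; lra.
rewrite ge0_integralZl//; last by move=> y _; exact: far_kernel_ge0.
apply: le_lt_trans (lee_wpmul2l _ (integral_far_kernel origin q0)) _.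
  by rewrite lee_fin mulr_ge0 ?exprn_ge0.
by rewrite -EFinM ltry.
Qed.

Definition gagliardo_integrand s (p : Rn R n * Rn R n) : R :=
  A (`|u p.1 - u p.2| / eucl_dist p.1 p.2 `^ s) / eucl_dist p.1 p.2 ^+ n.

Lemma gagliardo_integrand_ge0 s p : 0 <= gagliardo_integrand s p.
Proof. by rewrite divr_ge0 ?exp_young_ge0 ?exprn_ge0 ?eucl_dist_ge0. Qed.

Lemma gagliardo_integrandC s x y :
  gagliardo_integrand s (x, y) = gagliardo_integrand s (y, x).
Proof. by rewrite /gagliardo_integrand/= distrC eucl_distC. Qed.

Lemma measurable_gagliardo_integrand s :
  measurable_fun setT (gagliardo_integrand s).
Proof.
have md := @measurable_eucl_dist R n.
have -> : gagliardo_integrand s = fun p =>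
    A (`|u p.1 - u p.2| * (eucl_dist p.1 p.2) `^ (- s)) *
    (eucl_dist p.1 p.2) `^ (- n%:R).
  apply/funext => p; rewrite /gagliardo_integrand powRN.
  by rewrite powR_invn ?eucl_dist_ge0.
apply: measurable_funM.
  apply: (measurableT_comp (@measurable_exp_young R)).
  apply: measurable_funM.
    apply: measurableT_comp => //; apply: measurable_funB.
      exact: (measurableT_comp (measurable_bipolar i0) measurable_fst).
    exact: (measurableT_comp (measurable_bipolar i0) measurable_snd).
  exact: (measurableT_comp (measurable_powR _) md).
exact: (measurableT_comp (measurable_powR _) md).
Qed.

(** A bound of the jump by B for all distances and by B d for small ones is
    exactly what makes [cutoff] come out of the Young function. *)
Lemma exp_young_cutoff (s d B v : R) : 0 < s < 1 -> 0 < d -> 0 <= v ->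
  v <= B * Num.min 1 d -> A (v / d `^ s) <= cutoff s d * A B.
Proof.
move=> /andP[s0 s1] d0 v0 vB.
have ds0 : 0 < d `^ s by rewrite powR_gt0.
have B0 : 0 <= B.
  have m0 : 0 < Num.min 1 d by rewrite lt_min ltr01 d0.
  by rewrite -(pmulr_lge0 _ m0) (le_trans v0).
suff [h1 h2] : v / d `^ s <= cutoff s d * B /\ cutoff s d <= 1.
  apply: le_trans (exp_young_homo h1) (exp_young_scale _ B0).
  by rewrite cutoff_ge0.
rewrite /cutoff; case: (leP d 1) => d1 /=; split.
- rewrite ler_pdivrMr// mulrAC -powRD ?gt_eqF ?implybT ?subrK//.
  rewrite powRr1 ?(ltW d0)// mulrC (le_trans vB)// ler_wpM2l//.
  by rewrite ge_min lexx orbT.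
- apply: (@le_trans _ _ ((1 : R) `^ (1 - s))); last by rewrite powR1.
  by rewrite ge0_ler_powR ?nnegrE ?subr_ge0 ?(ltW s1) ?(ltW d0).
- rewrite [leRHS]mulrC ler_pM2r ?invr_gt0// (le_trans vB)// ler_piMr//.
  by rewrite ge_min lexx.
- rewrite invf_le1//.
  apply: (@le_trans _ _ ((1 : R) `^ s)); first by rewrite powR1.
  by rewrite ge0_ler_powR ?nnegrE ?(ltW s0) ?(ltW d0) ?(ltW d1).
Qed.

(** The distance d at which d^s = 2; beyond it the denominator compensates for
    the doubling of the argument. *)
Definition jump_radius s : R := 2 `^ (s^-1).

(** The indicator takes care of pairs with both points near the origin, where
    the envelope does not control the jump over short distances; 4 bounds both
    the jump of u and its Lipschitz constant there. *)
Definition majorant s x : R :=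
  A 4 * \1_[set z | supnorm z <= 4 * jump_radius s] x + 2 * A (g x).

Lemma majorant_ge0 s x : 0 <= majorant s x.
Proof. by rewrite addr_ge0// mulr_ge0// exp_young_ge0. Qed.

Lemma majorant_ge_envelope s x : 2 * A (g x) <= majorant s x.
Proof. by rewrite lerDr mulr_ge0// exp_young_ge0. Qed.

Lemma jump_radius_ge1 s : 0 < s -> 1 <= jump_radius s.
Proof.
by move=> s0; rewrite -[leLHS](powRr0 2) ler_powR ?invr_ge0 ?(ltW s0)// ler1n.
Qed.

(** With |y| <= |x|, three cases. If x is in the ball of the majorant,
    constants suffice. If x is outside and d <= [jump_radius s], the Lipschitz
    bound keeps the jump below g(y) min(1, d). If d is larger, the jump is at
    most 2 g(y), and d^s >= 2. *)
Lemma gagliardo_integrand_le s x y : 0 < s < 1 -> 0 < eucl_dist x y ->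
  gagliardo_integrand s (x, y) <=
    (majorant s x + majorant s y) *
    (cutoff s (eucl_dist x y) / eucl_dist x y ^+ n).
Proof.
wlog yx : x y / supnorm y <= supnorm x.
  move=> H s01.
  case: (leP (supnorm y) (supnorm x)) => [|/ltW] h; first exact: H.
  by rewrite gagliardo_integrandC addrC eucl_distC; exact: H.
move=> s01 d0; case/andP: (s01) => s0 s1.
rewrite /gagliardo_integrand/=; set d := eucl_dist x y in d0 *.
rewrite mulrA ler_pM2r ?invr_gt0 ?exprn_gt0//.
have Nx := supnorm_ge0 x; have Ny := supnorm_ge0 y.
have c0 := cutoff_ge0 s d.
have gy0 := envelope_gt0 i0 y.
have g2 := envelope_le2 i0 y.
have Agy := exp_young_ge0 (g y).
have D1 := jump_radius_ge1 s0.
have uu : `|u x - u y| <= 2 * g y.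
  rewrite (le_trans (ler_normB _ _))// mulr2n mulrDl !mul1r lerD//.
    exact: le_trans (bipolar_le i0 x) (envelope_anti i0 yx).
  exact: bipolar_le.
have lip := bipolar_lip i0 yx.
case: (leP (supnorm x) (4 * jump_radius s)) => xR.
  apply: (@le_trans _ _ (cutoff s d * A 4)).
    apply: exp_young_cutoff => //.
    rewrite /Num.min; case: ifPn => _; first by lra.
    apply: (le_trans lip); rewrite ler_pdivrMr; last by lra.
    rewrite -/d.
    have : 0 <= d * (2 - g y) by rewrite mulr_ge0 ?subr_ge0 ?(ltW d0).
    have : 0 <= d * supnorm x by rewrite mulr_ge0// ltW.
    by lra.
  rewrite mulrC ler_wpM2r// /majorant indicE mem_set// mulr1.
  have := majorant_ge0 s y; have := exp_young_ge0 (g x); rewrite /majorant.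
  by lra.
have mx := majorant_ge0 s x; have my := majorant_ge_envelope s y.
case: (leP d (jump_radius s)) => dD.
  apply: (@le_trans _ _ (cutoff s d * A (g y))).
    apply: exp_young_cutoff => //; apply: (le_trans lip).
    rewrite ler_pdivrMr -/d; last by lra.
    rewrite [leLHS](_ : _ = g y * (4 * d)); last by ring.
    rewrite -[leRHS]mulrA (ler_pM2l gy0); case: (ltP 1 d) => h.
      by rewrite mul1r; lra.
    rewrite mulrC ler_pM2l//; lra.
  by rewrite mulrC ler_wpM2r//; lra.
have d1 : 1 < d by lra.
have ds0 : 0 < d `^ s by rewrite powR_gt0.
have ds2 : 2 <= d `^ s.
  have -> : (2 : R) = jump_radius s `^ s.
    by rewrite /jump_radius -powRrM mulVf ?gt_eqF// powRr1.
  by rewrite ge0_ler_powR ?nnegrE ?powR_ge0 ?(ltW s0) ?(ltW d0) ?(ltW dD).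
apply: (@le_trans _ _ (2 / d `^ s * A (g y))).
  apply: (le_trans _ (exp_young_scale _ (ltW gy0))); last first.
    by rewrite divr_ge0 ?(ltW ds0)//= ler_pdivrMr// mul1r.
  by apply: exp_young_homo; rewrite mulrAC ler_pM2r ?invr_gt0.
rewrite /cutoff ifF; last by apply/negbTE; rewrite -ltNge.
rewrite mulrAC ler_wpM2r ?invr_ge0 ?(ltW ds0)//; lra.
Qed.

Lemma measurable_supnorm_ball (c : R) :
  measurable [set z : Rn R n | supnorm z <= c].
Proof.
rewrite -[X in measurable X]setTI; apply: measurable_fun_le => //.
exact: measurable_supnorm.
Qed.

Lemma lebesgue_supnorm_ball (c : R) :
  (mu [set z : Rn R n | (supnorm z <= c)%R] < +oo)%E.
Proof.
have c0 : 0 <= Num.max 0 c by rewrite le_max lexx.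
apply: (@le_lt_trans _ _ (mu (cube origin (Num.max 0 c)))).
  rewrite le_measure ?inE//; first exact: measurable_supnorm_ball.
    exact: measurable_cube.
  move=> z /= zc i; rewrite (le_trans (cube_origin z i))// (le_trans zc)//.
  by rewrite le_max lexx orbT.
by rewrite lebesgue_cube// ltry.
Qed.

Lemma measurable_majorant s : measurable_fun setT (majorant s).
Proof.
apply: measurable_funD; apply: measurable_funM => //.
  by apply: measurable_indic; exact: measurable_supnorm_ball.
apply: (measurableT_comp (@measurable_exp_young R)).
exact: measurable_envelope.
Qed.

Lemma integral_majorant s : (\int[mu]_x (majorant s x)%:E < +oo)%E.
Proof.
under eq_integral do rewrite EFinD !EFinM.
have mi : measurable_fun setT
    (\1_[set z : Rn R n | supnorm z <= 4 * jump_radius s] : _ -> R).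
  by apply: measurable_indic; exact: measurable_supnorm_ball.
have mA : measurable_fun setT (fun x => A (g x)).
  apply: (measurableT_comp (@measurable_exp_young R)).
  exact: measurable_envelope.
have A0 (t : R) : (0 <= (A t)%:E)%E by rewrite lee_fin exp_young_ge0.
rewrite ge0_integralD//; first last.
- by apply: emeasurable_funM => //; exact/measurable_EFinP.
- by move=> x _; rewrite mule_ge0.
- by apply: emeasurable_funM => //; exact/measurable_EFinP.
- by move=> x _; rewrite mule_ge0.
rewrite !ge0_integralZl//; try exact/measurable_EFinP.
rewrite integral_indic//; last exact: measurable_supnorm_ball.
rewrite setIT lte_add_pinfty// lte_mul_pinfty//.
  exact: lebesgue_supnorm_ball.
exact: integral_exp_young_envelope.
Qed.

Lemma gagliardo_bipolar_fin s : 0 < s < 1 -> (gagliardo s A u < +oo)%E.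
Proof.
move=> s01; have [C C0 intC] := @integral_riesz_bound R n s s01.
apply: (@le_lt_trans _ _ ((2 * C)%:E * \int[mu]_x (majorant s x)%:E)%E).
  apply: (@kernel_integral_le R n (EFin \o gagliardo_integrand s)
    (riesz_bound s)) => //.
  - apply/measurable_EFinP; exact: measurable_gagliardo_integrand.
  - exact: measurable_riesz_bound.
  - apply/measurable_EFinP; exact: measurable_majorant.
  - by move=> p; rewrite lee_fin gagliardo_integrand_ge0.
  - exact: riesz_bound_ge0.
  - by move=> x; rewrite lee_fin majorant_ge0.
  - exact: riesz_boundC.
  move=> x y; have := eucl_dist_ge0 x y.
  rewrite le_eqVlt => /predU1P[d0|d0].
    rewrite /= /gagliardo_integrand/= -d0 expr0n gtn_eqF//= invr0 mulr0.
    by rewrite mule_ge0 ?riesz_bound_ge0 ?adde_ge0 ?lee_fin ?majorant_ge0.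
  apply: le_trans (lee_wpmul2l _ (riesz_bound_ge s01 d0)); last first.
    by rewrite adde_ge0 ?lee_fin ?majorant_ge0.
  by rewrite -EFinD -EFinM lee_fin gagliardo_integrand_le.
rewrite lte_mul_pinfty ?lee_fin ?mulr_ge0//; exact: integral_majorant.
Qed.

Lemma superlevel_bipolar_fin (t : R) : 0 < t ->
  (mu [set x | (t < `|u x|)%R] < +oo)%E.
Proof.
move=> t0; have k0 := @kappa_gt0 R n i0.
apply: (@le_lt_trans _ _
  (mu [set z : Rn R n | (supnorm z <= expR (@kappa R n * t)^-1)%R]));
  last first.
  exact: lebesgue_supnorm_ball.
rewrite le_measure ?inE//; last 2 first.
- exact: measurable_supnorm_ball.
- move=> x /= tx; have N0 := supnorm_ge0 x; have l0 := ln2D_gt0 N0.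
  have := lt_le_trans tx (bipolar_le i0 x).
  rewrite /envelope -invfM -[X in X < _]invrK.
  rewrite ltf_pV2 ?posrE ?invr_gt0 ?mulr_gt0//.
  rewrite mulrC -ltr_pdivlMr// -invfM mulrC -ltr_expR lnK ?posrE; lra.
- rewrite (_ : mkset _ = ~` [set x | `|u x| <= t]); last first.
    by apply/seteqP; split => x /=; rewrite ltNge => /negP.
  apply: measurableC; rewrite -[X in measurable X]setTI.
  apply: measurable_fun_le => //.
  by apply: measurableT_comp => //; exact: measurable_bipolar.
Qed.

Lemma bipolar_Vd s : 0 < s -> s < 1 -> Vd n s A u.
Proof.
move=> s0 s1; split; first exact: measurable_bipolar.
  by apply: gagliardo_bipolar_fin; rewrite s0.
exact: superlevel_bipolar_fin.
Qed.

Lemma integral_exp_young_bipolar :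
  (\int[mu]_x (A `|u x|%R)%:E < +oo)%E.
Proof.
apply: le_lt_trans integral_exp_young_envelope.
have mAu : measurable_fun setT (fun x => A `|u x|).
  apply: (measurableT_comp (@measurable_exp_young R)).
  by apply: measurableT_comp => //; exact: measurable_bipolar.
apply: ge0_le_integral => //.
- by move=> x _; rewrite lee_fin exp_young_ge0.
- exact/measurable_EFinP.
- apply/measurable_EFinP; apply: (measurableT_comp (@measurable_exp_young R)).
  exact: measurable_envelope.
- by move=> x _; rewrite lee_fin; apply: exp_young_homo; exact: bipolar_le.
Qed.

End upper.

(** * Divergence as s tends to 0 *)

Section lower.
Context {R : realType} {n : nat}.
Variable i0 : 'I_n.
Implicit Types (x y : Rn R n) (s r : R).
Notation A := (@exp_young R).
Notation u := (@bipolar R n i0).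
Notation mu := (@lebesgue_Rn R n).

Lemma integral_young_bar_bipolar_le :
  (\int[mu]_x young_bar A `|u x|%R <= \int[mu]_x (A `|u x|%R)%:E)%E.
Proof.
have mu' : measurable_fun setT (fun x => `|u x|).
  by apply: measurableT_comp => //; exact: measurable_bipolar.
apply: ge0_le_integral => //.
- by move=> x _; exact: young_bar_ge0.
- exact: (measurableT_comp measurable_young_bar mu').
- apply/measurable_EFinP.
  exact: (measurableT_comp (@measurable_exp_young R) mu').
- by move=> x _; exact: young_bar_exp_young_le.
Qed.

Lemma double_integral_ge (F : Rn R n * Rn R n -> \bar R)
    (P Q : set (Rn R n)) (c : R) : 0 <= c ->
  measurable P -> measurable Q -> measurable_fun setT F ->
  (forall p, 0 <= F p)%E ->
  (forall x y, P x -> Q y -> (c%:E <= F (x, y))%E) ->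
  (c%:E * mu Q * mu P <= \int[mu]_x \int[mu]_y F (x, y))%E.
Proof.
move=> c0 mP mQ mF F0 cF.
have mi (S : set (Rn R n)) : measurable S ->
    measurable_fun setT (fun x => (\1_S x : R)%:E).
  by move=> mS; apply/measurable_EFinP; exact: measurable_indic.
have int1 (S : set (Rn R n)) (k : \bar R) : measurable S -> (0 <= k)%E ->
    (k * mu S = \int[mu]_x (k * (\1_S x)%:E))%E.
  move=> mS k0; rewrite ge0_integralZl//.
    by rewrite integral_indic// setIT.
  exact: mi.
have k0 : (0 <= c%:E * mu Q)%E by rewrite mule_ge0// lee_fin.
rewrite int1//; apply: ge0_le_integral => //.
- by move=> x _; rewrite mule_ge0// lee_fin.
- by apply: emeasurable_funM => //; exact: mi.
- exact: measurable_fun_fubini_tonelli_F.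
move=> x _; rewrite indicE; have [/set_mem Px|_] := boolP (x \in P); last first.
  by rewrite mule0 integral_ge0.
rewrite mule1 int1//; apply: ge0_le_integral => //.
- by move=> y _; rewrite mule_ge0// lee_fin.
- by apply: emeasurable_funM => //; exact: mi.
- exact: measurable_fun_pair2.
move=> y _; rewrite indicE; have [/set_mem Qy|_] := boolP (y \in Q).
  by rewrite mule1 cF.
by rewrite mule0.
Qed.

(** The two opposite boxes of the lower bound are the cases [a, b] = [r, 2r]
    and [a, b] = [-2r, -r]; on both of them the sup norm is the absolute value
    of the coordinate of index i0. *)
Definition slab (a b r : R) : set (Rn R n) :=
  [set x | forall i,
    (if i == i0 then `[a, b]%classic else `[0, r]%classic) (crd x i)].

Lemma measurable_slab a b r : measurable (slab a b r).
Proof.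
apply: (@measurable_box R n
  (fun i => if i == i0 then `[a, b]%classic else `[0, r]%classic)).
by move=> i; case: ifP => _; exact: measurable_itv.
Qed.

Lemma lebesgue_slab a r : 0 < r -> mu (slab a (a + r) r) = (r ^+ n)%:E.
Proof.
move=> r0; rewrite /slab (@lebesgue_Rn_box R n
  (fun i => if i == i0 then `[a, a + r]%classic else `[0, r]%classic));
  last first.
  by move=> i; case: ifP => _; exact: measurable_itv.
rewrite (eq_bigr (fun=> r%:E)) => [|i _].
  by rewrite prodEFin prodr_const card_ord.
case: ifP => _; rewrite lebesgue_measure_itv/= lte_fin ?ltrDl r0 -EFinD.
  by rewrite addrAC subrr add0r.
by rewrite subr0.
Qed.

Lemma logprofile_ge r t : 0 < r -> r <= t <= 2 * r ->
  r / (2 + r) / ln (2 + 2 * r) <= t * logprofile t.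
Proof.
move=> r0 /andP[rt tr].
have lt : 0 < ln (2 + t) by apply: ln2D_gt0; lra.
have lr : 0 < ln (2 + 2 * r) by apply: ln2D_gt0; lra.
rewrite /logprofile invfM mulrA ler_pM ?divr_ge0 ?invr_ge0 ?(ltW lr)//; try lra.
  rewrite ler_pdivrMr; last by lra.
  rewrite mulrAC ler_pdivlMr; last by lra.
  by lra.
by rewrite lef_pV2 ?posrE// ler_ln ?posrE; lra.
Qed.

Lemma slab_crd a b r x i : slab a b r x -> i != i0 -> 0 <= crd x i <= r.
Proof. by move=> /(_ i); case: ifP => // _; rewrite /= in_itv. Qed.

Lemma slab_crd0 a b r x : slab a b r x -> a <= crd x i0 <= b.
Proof. by move=> /(_ i0); rewrite eqxx /= in_itv. Qed.

Lemma supnorm_slab a b r x : slab a b r x -> r <= `|crd x i0| ->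
  supnorm x = `|crd x i0|.
Proof.
move=> xS rx; apply/eqP; rewrite eq_le le_supnorm andbT supnorm_le// => i.
have [->//|ii0] := eqVneq i i0.
have /andP[xi0 xir] := slab_crd xS ii0.
by rewrite ger0_norm// (le_trans xir).
Qed.

Lemma bipolar_slab_diff r x y : 0 < r ->
  slab r (r + r) r x -> slab (- (2 * r)) (- (2 * r) + r) r y ->
  (@kappa R n)^-1 * (2 * (r / (2 + r) / ln (2 + 2 * r))) <= u x - u y.
Proof.
move=> r0 xS yS.
have /andP[x1 x2] := slab_crd0 xS; have /andP[y1 y2] := slab_crd0 yS.
have k0 := @kappa_gt0 R n i0.
have nx : `|crd x i0| = crd x i0 by rewrite ger0_norm; lra.
have ny : `|crd y i0| = - crd y i0 by rewrite ler0_norm; lra.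
rewrite /bipolar -mulrBr ler_pM2l ?invr_gt0//.
rewrite (supnorm_slab xS) ?nx; last by lra.
rewrite (supnorm_slab yS) ?ny; last by lra.
rewrite -mulNr mulr2n mulrDl mul1r lerD// logprofile_ge//; lra.
Qed.

Lemma eucl_dist_slab r x y : 0 < r ->
  slab r (r + r) r x -> slab (- (2 * r)) (- (2 * r) + r) r y ->
  eucl_dist x y <= n%:R * (4 * r).
Proof.
move=> r0 xS yS; apply: eucl_dist_le; first by lra.
move=> i; rewrite ler_norml; have [->|ii0] := eqVneq i i0.
  have /andP[x1 x2] := slab_crd0 xS; have /andP[y1 y2] := slab_crd0 yS.
  by apply/andP; split; lra.
have /andP[x1 x2] := slab_crd xS ii0; have /andP[y1 y2] := slab_crd yS ii0.
by apply/andP; split; lra.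
Qed.

Lemma eucl_dist_slab_gt0 r x y : 0 < r ->
  slab r (r + r) r x -> slab (- (2 * r)) (- (2 * r) + r) r y ->
  0 < eucl_dist x y.
Proof.
move=> r0 xS yS; apply: lt_le_trans (crd_dist x y i0).
have /andP[x1 x2] := slab_crd0 xS; have /andP[y1 y2] := slab_crd0 yS.
by rewrite normr_gt0 subr_eq0; apply/eqP; lra.
Qed.

(** Here r = e^L. As L grows, the quotient times kappa L approaches 2
    e^(-1/20); the condition on L keeps it above 3/2. *)
Lemma jump_slab (s L : R) x y : 0 < s -> s * L = 20^-1 -> 80 * n%:R <= L ->
  slab (expR L) (expR L + expR L) (expR L) x ->
  slab (- (2 * expR L)) (- (2 * expR L) + expR L) (expR L) y ->
  3 / 2 / (@kappa R n * L) <= `|u x - u y| / eucl_dist x y `^ s.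
Proof.
move=> s0 sL nL xS yS.
have k0 := @kappa_gt0 R n i0; have n1 := @dim_ge1 R n i0.
have L0 : 0 < L by lra.
set r := expR L in xS yS *.
have r40 : 40 <= r by apply: le_trans (expR_ge1Dx L); lra.
have r0 : 0 < r by lra.
(* Dimensional constants cost a factor e^(L/20), because L >= 80 n. *)
have rn : n%:R * (4 * r) <= expR (21 / 20 * L).
  rewrite (_ : 21 / 20 * L = L / 20 + L); last by field.
  rewrite expRD mulrA ler_pM2r//.
  by apply: le_trans (expR_ge1Dx _); lra.
have lnr : ln (2 + 2 * r) <= 21 / 20 * L.
  rewrite -[leRHS]expRK ler_ln ?posrE ?expR_gt0//; last by lra.
  apply: le_trans rn; apply: (@le_trans _ _ (4 * r)); first by lra.
  by rewrite ler_peMl//; lra.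
have ds : eucl_dist x y `^ s <= 400 / 379.
  have d0 := eucl_dist_ge0 x y.
  apply: (@le_trans _ _ (expR (21 / 20 * L) `^ s)).
    rewrite ge0_ler_powR ?nnegrE ?(ltW s0) ?expR_ge0//.
    exact: le_trans (eucl_dist_slab r0 xS yS) rn.
  rewrite -expRM (_ : 21 / 20 * L * s = 21 / 400); last first.
    by rewrite -mulrA (mulrC L) sL; field.
  rewrite -[21 / 400]opprK expRN -[leRHS]invf_div.
  rewrite lef_pV2 ?posrE; [|exact: expR_gt0|lra].
  by apply: le_trans (expR_ge1Dx _); lra.
have dgt0 := eucl_dist_slab_gt0 r0 xS yS.
have ds0 : 0 < eucl_dist x y `^ s by rewrite powR_gt0.
rewrite ler_pdivlMr//.
apply: le_trans (le_trans (bipolar_slab_diff r0 xS yS) (ler_norm _)).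
apply: (@le_trans _ _ (3 / 2 / (@kappa R n * L) * (400 / 379))).
  by rewrite ler_wpM2l// divr_ge0 ?mulr_ge0 ?(ltW k0) ?(ltW L0).
rewrite invfM -[leLHS]mulrA [leLHS]mulrCA -!mulrA ler_pM2l ?invr_gt0//.
have lr0 : 0 < ln (2 + 2 * r) by apply: ln2D_gt0; lra.
have h1 : 20 / 21 <= r / (2 + r) by rewrite ler_pdivlMr; lra.
have h2 : L^-1 * (20 / 21) <= (ln (2 + 2 * r))^-1.
  rewrite (_ : L^-1 * (20 / 21) = (21 / 20 * L)^-1); last first.
    by field; rewrite gt_eqF.
  by rewrite lef_pV2 ?posrE// ; lra.
(* The losses still leave 2 (20/21)^2 (379/400) > 3/2. *)
have h3 : 20 / 21 * (L^-1 * (20 / 21)) <= r / (2 + r) * (ln (2 + 2 * r))^-1.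
  by apply: ler_pM => //; rewrite mulr_ge0 ?invr_ge0 ?(ltW L0)//.
have Li : 0 < L^-1 by rewrite invr_gt0.
rewrite mulrA in h3; lra.
Qed.

(** The boxes have measure e^(Ln), their points are at distance at most 4 n
    e^L, and on them the argument of the Young function is at least t = (3/2) /
    (kappa L). The exponents add up to L (n - 2 kappa / 3), which is at least
    L/6. *)
Lemma gagliardo_bipolar_ge (s L : R) : 0 < s -> s * L = 20^-1 ->
  80 * n%:R <= L ->
  ((3 / 2 / (@kappa R n * L) * expR (L / 6) / (4 * n%:R) ^+ n)%:E <=
    gagliardo s A u)%E.
Proof.
move=> s0 sL nL.
have k0 := @kappa_gt0 R n i0; have n1 := @dim_ge1 R n i0.
have L0 : 0 < L by lra.
pose r := expR L; have r0 : 0 < r by exact: expR_gt0.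
pose t := 3 / 2 / (@kappa R n * L).
have t0 : 0 < t by rewrite divr_gt0// mulr_gt0.
pose c := A t / (n%:R * (4 * r)) ^+ n.
have nr0 : 0 < n%:R * (4 * r) by rewrite mulr_gt0 ?mulr_gt0//; lra.
have c0 : 0 <= c by rewrite divr_ge0 ?exp_young_ge0 ?exprn_ge0 ?(ltW nr0).
have mG := measurable_gagliardo_integrand i0 s.
apply: (le_trans _ (@double_integral_ge (EFin \o gagliardo_integrand i0 s)
  (slab r (r + r) r) (slab (- (2 * r)) (- (2 * r) + r) r) c c0
  (@measurable_slab _ _ _) (@measurable_slab _ _ _) _ _ _)); last 3 first.
- exact/measurable_EFinP.
- by move=> p; rewrite lee_fin gagliardo_integrand_ge0.
- move=> x y xS yS; rewrite lee_fin /gagliardo_integrand/= /c.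
  have d0 := eucl_dist_slab_gt0 r0 xS yS.
  apply: ler_pM; rewrite ?exp_young_ge0 ?invr_ge0 ?exprn_ge0 ?(ltW nr0)//.
    by apply: exp_young_homo; exact: jump_slab.
  rewrite lef_pV2 ?posrE ?exprn_gt0// lerXn2r ?nnegrE ?(ltW nr0) ?(ltW d0)//.
  exact: eucl_dist_slab.
rewrite !lebesgue_slab// -!EFinM lee_fin /c.
rewrite exp_young_pos// -/t.
rewrite [leRHS](_ : _ =
    t * (r ^+ n * expR (- t^-1)) / (4 * n%:R) ^+ n); last first.
  by rewrite !exprMn; field; rewrite ?expf_neq0 ?gt_eqF//; lra.
rewrite ler_pM2r ?invr_gt0 ?exprn_gt0 ?mulr_gt0//; last by lra.
rewrite ler_pM2l// /r -expRM_natl -expRD ler_expR.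
have -> : t^-1 = 2 / 3 * (n%:R + 4^-1) * L.
  by rewrite /t /kappa; field; rewrite !gt_eqF.
have : 0 <= L * (n%:R - 1) by rewrite mulr_ge0 ?(ltW L0)//; lra.
by lra.
Qed.

(** With L = 1 / (20 s), the bound e^x >= x^3 / 6 already gives s times the
    integral at least c / s. *)
Lemma gagliardo_bipolar_cvg :
  (s%:E * gagliardo s A u)%E @[s --> 0^'+] --> +oo%E.
Proof.
have k0 := @kappa_gt0 R n i0; have n1 := @dim_ge1 R n i0.
(* 1296 = 6^3 * 3! comes from the cubic lower bound of e^(L/6), and 400 = 20^2 from
   s L^2 = 1 / (400 s). *)
pose c : R := (3 / 2 / @kappa R n / (4 * n%:R) ^+ n) / 1296 / 400.
have n0 : 0 < n%:R :> R by lra.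
have p4n : 0 < (4 * n%:R) ^+ n :> R by rewrite exprn_gt0// mulr_gt0.
have c0 : 0 < c.
  have h : 0 < 3 / 2 / @kappa R n / (4 * n%:R) ^+ n.
    by apply: divr_gt0 => //; apply: divr_gt0 => //; lra.
  by rewrite /c; lra.
apply/cvgeyPge => M.
have M0 : 0 < `|M| + 1 by rewrite ltr_wpDl.
have n1600 : 0 < 1600 * n%:R :> R by lra.
have a0 : 0 < (1600 * n%:R)^-1 :> R by rewrite invr_gt0.
have b0 : 0 < c / (`|M| + 1) by rewrite divr_gt0.
near=> s.
have s0 : 0 < s by near: s; exact: nbhs_right_gt.
have sa : s < (1600 * n%:R)^-1 by near: s; exact: nbhs_right_lt.
have sb : s < c / (`|M| + 1) by near: s; exact: nbhs_right_lt.
pose L := (20 * s)^-1.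
have sL : s * L = 20^-1 by rewrite /L; field; rewrite gt_eqF.
have nL : 80 * n%:R <= L.
  have sn : s * (1600 * n%:R) < 1.
    by rewrite -(ltr_pdivlMr _ _ n1600) div1r; exact: sa.
  by rewrite /L -[leRHS]mul1r ler_pdivlMr; lra.
have L0 : 0 < L by lra.
apply: (@le_trans _ _ (s%:E *
  (3 / 2 / (@kappa R n * L) * expR (L / 6) / (4 * n%:R) ^+ n)%:E)%E);
  last first.
  by rewrite lee_wpmul2l ?lee_fin ?(ltW s0)// gagliardo_bipolar_ge.
rewrite -EFinM lee_fin.
apply: (@le_trans _ _ (c / s)).
  rewrite (le_trans (ler_norm _))// (@le_trans _ _ (`|M| + 1))//.
    by rewrite lerDl.
  rewrite ler_pdivlMr// mulrC -ler_pdivlMr// ltW//.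
have e : L ^+ 3 / 1296 <= expR (L / 6).
  apply: (@le_trans _ _ (1 + (L / 6) ^+ 3 / 3`!%:R)); last first.
    by apply: expR_ge1Dxn; rewrite divr_ge0// ltW.
  rewrite (_ : 3`!%:R = 6 :> R)//.
  by rewrite exprMn exprVn; lra.
apply: (@le_trans _ _ (s *
  (3 / 2 / (@kappa R n * L) * (L ^+ 3 / 1296) / (4 * n%:R) ^+ n))).
  rewrite /c /L le_eqVlt; apply/orP; left; apply/eqP.
  by field; rewrite ?expf_neq0 ?mulf_neq0 ?gt_eqF.
rewrite ler_pM2l// ler_pM2r ?invr_gt0 ?exprn_gt0 ?mulr_gt0//.
by rewrite ler_pM2l// divr_gt0 ?mulr_gt0.
Unshelve. all: by end_near.
Qed.

End lower.

Unset Implicit Arguments.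
Set Strict Implicit.

Theorem theorem1p2 (R : realType) (n : nat) (n_ge1 : (1 <= n)%N) :
  exists A : R -> R,
    [/\ young_function A, ~ Delta2 A &
      exists u : Rn R n -> R,
        [/\ forall s : R, 0 < s -> s < 1 -> Vd n s A u,
            (\int[lebesgue_Rn n]_x young_bar A `|u x|%R <=
             \int[lebesgue_Rn n]_x (A `|u x|%R)%:E)%E,
            (\int[lebesgue_Rn n]_x (A `|u x|%R)%:E < +oo)%E &
            (s%:E * gagliardo s A u)%E @[s --> 0^'+] --> +oo%E]].
Proof.
exists (@exp_young R); split.
- exact: exp_young_young.
- exact: exp_young_not_Delta2.
exists (bipolar (Ordinal n_ge1)); split.
- exact: bipolar_Vd.
- exact: integral_young_bar_bipolar_le.
- exact: integral_exp_young_bipolar.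
- exact: gagliardo_bipolar_cvg.
Qed.
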